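(* Let $\mathbf u,\mathbf v$ be sequences of non-zero scalars, and let $\mu_{\mathbf u}=\bigotimes_{n\ge0}\mu_{\mathbf u,n}$ and $\mu_{\mathbf v}=\bigotimes_{n\ge0}\mu_{\mathbf v,n}$ be Gaussian product measures on $\mathbb K^{\mathbb Z_+}$ which are invariant under $B_{\mathbf u}$ and $B_{\mathbf v}$ respectively, with $\mu_{\mathbf u,0}=\mathcal N(0,\sigma^2)$ and $\mu_{\mathbf v,0}=\mathcal N(0,\sigma'^2)$ ($\sigma,\sigma'>0$). Then $\mu_{\mathbf u}$ and $\mu_{\mathbf v}$ are either equivalent or mutually singular, and they are equivalent if and only if $$\sum_{n=1}^\infty\left(1-\frac{\sigma'}{\sigma}\,\frac{|u_1\cdots u_n|}{|v_1\cdots v_n|}\right)^2<\infty.$$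
   Context: $\mathbb K\in\{\mathbb R,\mathbb C\}$. For $\sigma>0$, $\mathcal N(0,\sigma^2)$ denotes the centered Gaussian measure on $\mathbb K$ with covariance matrix $\sigma^2 I_{\mathbb K}$ (identifying $\mathbb C$ with $\mathbb R^2$ in the complex case). A Gaussian product measure on $\mathbb K^{\mathbb Z_+}$ is a product $\bigotimes_{n\ge0}\mu_n$ with each $\mu_n=\mathcal N(0,\sigma_n^2)$ for some $\sigma_n>0$. $B_{\mathbf w}:\mathbb K^{\mathbb Z_+}\to\mathbb K^{\mathbb Z_+}$ is $(B_{\mathbf w}t)_j=w_{j+1}t_{j+1}$, and invariance means $\mu(B_{\mathbf w}^{-1}B)=\mu(B)$ for Borel $B$ (product topology). *)

(* Defs.v *)
From HB Require Import structures.
From mathcomp Require Import all_boot all_order all_algebra.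
From mathcomp Require Import all_classical all_reals all_analysis.
Set Implicit Arguments. Unset Strict Implicit. Unset Printing Implicit Defensive.
Import Order.TTheory GRing.Theory Num.Theory.
Local Open Scope classical_set_scope.
Local Open Scope ring_scope.

(* The scalar field K is either R or C.  C is modelled, as in the paper,   *)
(* by R^2 = R * R (with its Borel = product sigma-algebra) together with  *)
(* complex multiplication, unit and modulus.                               *)
Section complex_as_pairs.
Context {R : realType}.
Definition cmul (z w : R * R) : R * R :=
  (z.1 * w.1 - z.2 * w.2, z.1 * w.2 + z.2 * w.1).
Definition cone : R * R := (1, 0).
Definition cnorm (z : R * R) : R := Num.sqrt (z.1 ^+ 2 + z.2 ^+ 2).
(* N(0, s^2) on C = R^2 with covariance s^2 I_2 *)
Definition cgauss (s : R) : set (R * R) -> \bar R :=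
  (normal_prob 0 s \x normal_prob 0 s)%E.
End complex_as_pairs.

(* real scalars: N(0, s^2) on R (s = standard deviation) *)
Definition rgauss {R : realType} (s : R) : set R -> \bar R := normal_prob 0 s.

Section sequence_space.
Context {d : measure_display} (K : measurableType d).

Definition cyl_gen : set (set (nat -> K)) :=
  [set B | exists k (A : set K), measurable A /\
     B = (fun t : nat -> K => t k) @^-1` A].

(* K^{Z_+} with the product sigma-algebra (= Borel sigma-algebra of the
   product topology, K being second countable) *)
Definition seqspace := g_sigma_algebraType cyl_gen.

Context {R : realType}.

(* mu is the product measure \bigotimes_n gauss (sig n): it is determined
   by its values on measurable cylinders *)
Definition is_gaussian_product (gauss : R -> set K -> \bar R) (sig : nat -> R)
    (mu : set seqspace -> \bar R) : Prop :=
  (forall n, 0 < sig n) /\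
  (forall (n : nat) (A : nat -> set K), (forall k, measurable (A k)) ->
     mu [set t : seqspace | forall k, (k < n)%N -> A k (t k)] =
     (\prod_(k < n) gauss (sig k) (A k))%E).

Definition wshift (mulK : K -> K -> K) (w : nat -> K) (t : seqspace) : seqspace :=
  fun j => mulK (w j.+1) (t j.+1).

Definition shift_invariant (mulK : K -> K -> K) (w : nat -> K)
    (mu : set seqspace -> \bar R) : Prop :=
  forall B : set seqspace, measurable B -> mu (wshift mulK w @^-1` B) = mu B.

Definition measures_equivalent (mu nu : set seqspace -> \bar R) : Prop :=
  mu `<< nu /\ nu `<< mu.

Definition mutually_singular (mu nu : set seqspace -> \bar R) : Prop :=
  exists A : set seqspace, measurable A /\ mu A = 0%E /\ nu (~` A) = 0%E.

Definition gaussian_dichotomy_statement (zeroK oneK : K) (mulK : K -> K -> K)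
    (normK : K -> R) (gauss : R -> set K -> \bar R) : Prop :=
  forall (u v : nat -> K) (su sv : nat -> R)
         (mu_u mu_v : {measure set seqspace -> \bar R}),
    (forall n, u n != zeroK) -> (forall n, v n != zeroK) ->
    is_gaussian_product gauss su mu_u -> is_gaussian_product gauss sv mu_v ->
    shift_invariant mulK u mu_u -> shift_invariant mulK v mu_v ->
    (measures_equivalent mu_u mu_v \/ mutually_singular mu_u mu_v) /\
    (measures_equivalent mu_u mu_v <->
      (\sum_(1 <= n <oo)
         ((1 - (sv 0%N / su 0%N) *
                 (normK (\big[mulK/oneK]_(1 <= i < n.+1) u i) /
                  normK (\big[mulK/oneK]_(1 <= i < n.+1) v i))) ^+ 2)%:E
       < +oo)%E).
End sequence_space.

(* Main.v *)
(* Invariance forces [sigma_n = |w_(n+1)| sigma_(n+1)] (compare the integrals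
   of [exp (- |x|^2 / 2)] before and after the shift), so the [n]-th term of
   the series is [(1 - t_n / s_n)^2], where [s_n] and [t_n] are the standard
   deviations of the factors.  The rest is Kakutani's dichotomy.  Let [F_n] be
   the density of nu with respect to mu on the first [n] coordinates; the
   integral of [sqrt (F_m F_n)] is the product of the Hellinger affinities
   [rho_k] over [m <= k < n].
   - If the tail products tend to 1, the measures [F_n mu] form a Cauchy
     sequence in total variation; the sets on which they converge to nu form a
     lambda-system containing the cylinders, hence nu << mu.
   - If the products tend to 0, Markov's inequality bounds both [mu {F_n >= 1}]
     and [nu {F_n < 1}] by [rho_0 ... rho_(n-1)], and Borel-Cantelli along a
     subsequence separates mu from nu.
   For Gaussian factors [rho_k] lies between [1 - x_k] and [1 - x_k / 2], where
   [x_k = (s_k - t_k)^2 / (s_k^2 + t_k^2)]; the series of the [x_k] and of the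
   [(1 - t_k / s_k)^2] converge simultaneously. *)

Require Import Defs.
From HB Require Import structures.
From mathcomp Require Import all_boot all_order all_algebra.
From mathcomp Require Import all_classical all_reals all_analysis.
From mathcomp Require Import measurable_realfun normal_distribution ring lra.
Set Implicit Arguments.
Unset Strict Implicit.
Unset Printing Implicit Defensive.
Import Order.TTheory GRing.Theory Num.Theory numFieldNormedType.Exports.
Local Open Scope classical_set_scope.
Local Open Scope ring_scope.

(** * Densities *)

Section density.
Context d (T : measurableType d) (R : realType).
Variables (mu nu : {measure set T -> \bar R}) (g : T -> R).
Hypotheses (mg : measurable_fun setT g) (g0 : forall x, 0 <= g x).
Hypothesis nuE :
  forall A, measurable A -> nu A = (\int[mu]_(x in A) (g x)%:E)%E.
Local Open Scope ereal_scope.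
Import HBNNSimple.

Let integral_density_indic A : measurable A ->
  \int[nu]_x (\1_A x)%:E = \int[mu]_x ((\1_A x)%:E * (g x)%:E).
Proof.
move=> mA; rewrite integral_indic// setIT nuE// [LHS]integral_mkcond.
apply: eq_integral => x _; rewrite patchE indicE.
by case: ifPn => xA; rewrite ?mul1e ?mul0e.
Qed.

Let integral_density_nnsfun (h : {nnsfun T >-> R}) :
  \int[nu]_x (h x)%:E = \int[mu]_x ((h x)%:E * (g x)%:E).
Proof.
under [LHS]eq_integral do rewrite fimfunE -fsumEFin//.
rewrite [LHS]ge0_integral_fsum//; last 2 first.
  - by move=> r; exact/measurable_EFinP/measurableT_comp.
  - by move=> n x _; rewrite EFinM nnfun_muleindic_ge0.
under [RHS]eq_integral.
  move=> x xD; rewrite fimfunE -fsumEFin// ge0_mule_fsuml; last first.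
    by move=> r; rewrite EFinM nnfun_muleindic_ge0.
  over.
rewrite [RHS]ge0_integral_fsum//; last 2 first.
  - move=> r; apply: emeasurable_funM; last exact/measurable_EFinP.
    exact/measurable_EFinP/measurableT_comp.
  - move=> n x _; apply: mule_ge0; last by rewrite lee_fin.
    by rewrite EFinM nnfun_muleindic_ge0.
apply: eq_fsbigr => r _.
(* A nonnegative [h] takes no negative value: the preimage is empty and both sides vanish. *)
have [r0|r0] := leP 0%R r; last first.
  rewrite preimage_nnfun0//.
  by rewrite !integral0_eq// => x _; rewrite indic0 mulr0 ?mul0e.
under eq_integral do rewrite EFinM.
under [RHS]eq_integral do rewrite EFinM -muleA.
rewrite !ge0_integralZl//.
- by rewrite integral_density_indic.
- by apply: emeasurable_funM; exact/measurable_EFinP.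
- by move=> x _; rewrite mule_ge0 ?lee_fin.
- exact/measurable_EFinP.
Qed.

(** The identity passes from indicators to simple functions and then, by monotone convergence, to
    all nonnegative functions. No finiteness of [mu] is assumed, so Lebesgue measure is covered. *)
Lemma ge0_integral_density (h : T -> \bar R) :
  measurable_fun setT h -> (forall x, 0 <= h x) ->
  \int[nu]_x h x = \int[mu]_x (h x * (g x)%:E).
Proof.
move=> mh h0.
pose h_ := nnsfun_approx measurableT mh.
have h_h x : (h_ n x)%:E @[n --> \oo] --> h x by exact: cvg_nnsfun_approx.
transitivity (lim (\int[nu]_x (h_ n x)%:E @[n --> \oo])).
  rewrite -monotone_convergence//=.
  - by apply: eq_integral => x _; apply/esym/cvg_lim.
  - by move=> n; exact/measurable_EFinP/measurable_funTS.
  - by move=> n ? _; rewrite lee_fin.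
  - by move=> ? _ ? ? mn; rewrite lee_fin; exact/lefP/nd_nnsfun_approx.
under eq_fun do rewrite integral_density_nnsfun.
rewrite -monotone_convergence//=.
- apply: eq_integral => x _; apply/cvg_lim => //.
  by apply: cvgeZr => //; exact: h_h.
- by move=> n; apply: emeasurable_funM; exact/measurable_EFinP.
- by move=> n ? _; rewrite mule_ge0 ?lee_fin.
- move=> x _ m n mn; rewrite lee_wpmul2r ?lee_fin//.
  exact/lefP/nd_nnsfun_approx.
Qed.

End density.

Section density_probability.
Context d (T : measurableType d) (R : realType).
Variables (mu : {measure set T -> \bar R}) (g : T -> R).

(** The proofs are arguments so that the probability structure below can be inferred from the term
    alone. *)
Definition density_prob (mg : measurable_fun setT g) (g0 : forall x, 0 <= g x)
    (g1 : (\int[mu]_x (g x)%:E = 1)%E) : set T -> \bar R :=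
  fun A => (\int[mu]_(x in A) (g x)%:E)%E.

Hypotheses (mg : measurable_fun setT g) (g0 : forall x, 0 <= g x)
  (g1 : (\int[mu]_x (g x)%:E = 1)%E).
Local Notation P := (density_prob mg g0 g1).

Let density0 : P set0 = 0%E. Proof. exact: integral_set0. Qed.

Let density_ge0 A : (0 <= P A)%E.
Proof. by apply: integral_ge0 => x _; rewrite lee_fin. Qed.

Let density_sigma_additive : semi_sigma_additive P.
Proof.
move=> /= F mF tF mUF; rewrite /density_prob; apply: cvg_toP.
  apply: ereal_nondecreasing_is_cvgn => m n mn.
  apply: lee_sum_nneg_natr => // k _ _.
  by apply: integral_ge0 => /= x _; rewrite lee_fin.
rewrite ge0_integral_bigcup//=.
- by apply: measurable_funTS; exact/measurable_EFinP.
- by move=> x _; rewrite lee_fin.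
Qed.

HB.instance Definition _ := isMeasure.Build _ _ _ P
  density0 density_ge0 density_sigma_additive.

HB.instance Definition _ := @Measure_isProbability.Build _ _ R P g1.

End density_probability.

Section measure_probability.
Context d (T : measurableType d) (R : realType).

(** A wrapper that carries the proof of total mass one, so that a bare measure can be used as a
    [probability]. *)
Definition measure_probability (mu : {measure set T -> \bar R})
  (mu1 : mu setT = 1%E) : set T -> \bar R := mu.

Variables (mu : {measure set T -> \bar R}) (mu1 : mu setT = 1%E).

HB.instance Definition _ := Measure.copy (measure_probability mu1) mu.

HB.instance Definition _ :=
  @Measure_isProbability.Build _ _ _ (measure_probability mu1) mu1.

End measure_probability.

(** * Product measures on the sequence space *)

Section sequences.
Context d (K : measurableType d) (R : realType).
Local Notation S := (seqspace K).

Definition cylinder n (A : nat -> set K) : set S :=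
  [set t | forall k, (k < n)%N -> A k (t k)].

Lemma measurable_coord k : measurable_fun setT (fun t : S => t k).
Proof.
move=> _ A mA; rewrite setTI; apply: sub_sigma_algebra.
by exists k, A.
Qed.

Lemma cylinderE n A : cylinder n A =
  \bigcap_(k in [set k | (k < n)%N]) ((fun t : S => t k) @^-1` A k).
Proof. by apply/seteqP; split => t /= h k /= /h. Qed.

Lemma measurable_cylinder n A :
  (forall k, measurable (A k)) -> measurable (cylinder n A).
Proof.
move=> mA; rewrite cylinderE; apply: bigcap_measurableType => // k _.
by rewrite -[_ @^-1` _]setTI; exact: measurable_coord.
Qed.

Lemma measurable_seqspace d' (T : measurableType d') (f : T -> S) :
  (forall k, measurable_fun setT (fun x => f x k)) -> measurable_fun setT f.
Proof.
move=> mf; apply: (@measurability _ _ T S setT f (@cyl_gen _ K) erefl).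
move=> _ [_ [k [A [mA ->]]] <-].
by rewrite -comp_preimage; exact: mf.
Qed.

Definition measurable_cylinders : set (set S) :=
  [set C | exists n A, (forall k, measurable (A k)) /\ C = cylinder n A].

Lemma setI_closed_cylinders : setI_closed measurable_cylinders.
Proof.
move=> _ _ [m [A [mA ->]]] [n [B [mB ->]]].
(* Both families of bases are padded with [setT] up to the larger length. *)
exists (maxn m n), (fun k => (if (k < m)%N then A k else setT) `&`
                            (if (k < n)%N then B k else setT)); split.
  by move=> k; apply: measurableI; case: ifP.
apply/seteqP; split => t /=.
  by move=> [tA tB] k _; split; case: ifP => // ?; [exact: tA|exact: tB].
move=> h; split => k kn.
  have [|+ _] := h k; first by rewrite leq_max kn.
  by rewrite kn.
have [|_] := h k; first by rewrite leq_max kn orbT.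
by rewrite kn.
Qed.

Lemma sigma_algebra_cylinders :
  @measurable _ S = <<s measurable_cylinders >>.
Proof.
apply/seteqP; split; last first.
  apply: smallest_sub; first exact: sigma_algebra_measurable.
  by move=> _ [n [A [mA ->]]]; exact: measurable_cylinder.
apply: smallest_sub; first exact: smallest_sigma_algebra.
move=> _ [k [A [mA ->]]]; apply: sub_gen_smallest.
exists k.+1, (fun j => if j == k then A else setT); split.
  by move=> j; case: ifP.
apply/seteqP; split => t /=.
  by move=> At j _; case: eqP => // ->.
by move=> /(_ k (ltnSn k)); rewrite eqxx.
Qed.

(** Uniqueness on a generating pi-system; the finite mass of [mu] makes the constant cover by [setT]
    admissible. *)
Lemma seqspace_measure_unique (mu : probability S R)
    (nu : {measure set S -> \bar R}) :
  (forall n A, (forall k, measurable (A k)) ->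
     mu (cylinder n A) = nu (cylinder n A)) ->
  forall B, measurable B -> mu B = nu B.
Proof.
move=> munu; have cylT : measurable_cylinders setT.
  exists 0%N, (fun=> setT); split => //.
  by apply/seteqP; split.
apply: (measure_unique measurable_cylinders (fun=> setT)) => //.
- exact: sigma_algebra_cylinders.
- exact: setI_closed_cylinders.
- by rewrite bigcup_const.
- by move=> _ [n [A [mA ->]]]; exact: munu.
- by move=> _; rewrite [ltLHS](@probability_setT _ _ _ mu) ltry.
Qed.

Definition is_product_measure (m : nat -> probability K R)
    (mu : set S -> \bar R) :=
  forall n A, (forall k, measurable (A k)) ->
    mu (cylinder n A) = (\prod_(k < n) m k (A k))%E.

(** Splitting off the first coordinate reduces finitely many coordinates to an induction over binary
    products. *)
Definition scons (xt : K * S) : S :=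
  fun k => if k is k'.+1 then xt.2 k' else xt.1.

Definition stail (t : S) : S := fun k => t k.+1.

Lemma measurable_scons : measurable_fun setT scons.
Proof.
apply: measurable_seqspace => -[|k] /=; first exact: measurable_fst.
exact: (measurableT_comp (measurable_coord k) measurable_snd).
Qed.

Lemma measurable_stail : measurable_fun setT stail.
Proof. by apply: measurable_seqspace => k; exact: measurable_coord. Qed.

HB.instance Definition _ :=
  isMeasurableFun.Build _ _ _ _ scons measurable_scons.
HB.instance Definition _ :=
  isMeasurableFun.Build _ _ _ _ stail measurable_stail.

Lemma is_product_measure_tail m (mu : probability S R) :
  is_product_measure m mu ->
  is_product_measure (fun k => m k.+1) (distribution mu stail).
Proof.
move=> muE n A mA; rewrite /distribution /pushforward.
transitivity (mu (cylinder n.+1 (fun k => if k is k'.+1 then A k' else setT))).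
  congr (mu _); apply/seteqP; split => t /= h; first by case.
  by move=> k kn; exact: (h k.+1).
rewrite muE; last by case.
by rewrite big_ord_recl/= probability_setT mul1e.
Qed.

(** Under [scons], a cylinder pulls back to a rectangle, so both measures agree on cylinders and
    uniqueness applies. *)
Lemma is_product_measure_cons m (mu : probability S R) :
  is_product_measure m mu -> forall B, measurable B ->
  distribution (m 0%N \x distribution mu stail)%E scons B = mu B.
Proof.
move=> muE.
apply: (@seqspace_measure_unique
  (distribution (m 0%N \x distribution mu stail)%E scons) mu).
move=> n A mA; rewrite /distribution {1}/pushforward/=.
case: n => [|n].
  rewrite (_ : cylinder 0 A = setT); last by apply/seteqP; split.
  by rewrite preimage_setT !probability_setT.
rewrite (_ : _ @^-1` _ = A 0%N `*` cylinder n (fun k => A k.+1)).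
  rewrite product_measure1E//; last exact: measurable_cylinder.
  rewrite muE// big_ord_recl.
  by congr (_ * _)%E; apply: (is_product_measure_tail muE).
apply/seteqP; split => -[x t] /=.
  by move=> h; split; [exact: (h 0%N)|move=> k kn; exact: (h k.+1)].
by move=> [Ax tA] [|k] kn//; exact: tA.
Qed.

Lemma measurable_prod_coord n (h : nat -> K -> R) :
  (forall k, measurable_fun setT (h k)) ->
  measurable_fun setT (fun t : S => \prod_(k < n) h k (t k)).
Proof.
move=> mh; apply: measurable_prod => k _.
exact: (measurableT_comp (mh k) (measurable_coord k)).
Qed.

(** Independence of the coordinates, by Tonelli after peeling off the first one. The induction
    generalizes over [h], [m] and [mu], since the tail has the shifted families. *)
Lemma integral_prod_coord n (h : nat -> K -> R) m (mu : probability S R) :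
  is_product_measure m mu ->
  (forall k, measurable_fun setT (h k)) -> (forall k x, 0 <= h k x) ->
  (\int[mu]_t (\prod_(k < n) h k (t k))%:E =
   \prod_(k < n) \int[m k]_x (h k x)%:E)%E.
Proof.
elim: n h m mu => [|n IHn] h m mu muE mh h0.
  rewrite big_ord0; under eq_integral do rewrite big_ord0.
  by rewrite integral_cst// mul1e; apply: (@probability_setT _ _ _ mu).
have mprod : measurable_fun [set: S]
    (EFin \o (fun t : S => \prod_(k < n.+1) h k (t k))).
  by apply/measurable_EFinP; exact: measurable_prod_coord.
transitivity (\int[distribution (m 0%N \x distribution mu stail)%E scons]_t
   (\prod_(k < n.+1) h k (t k))%:E)%E.
  apply: eq_measure_integral => A mA _; apply/esym.
  by apply: (is_product_measure_cons muE mA).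
rewrite ge0_integral_distribution//; last first.
  by move=> t; rewrite lee_fin prodr_ge0.
rewrite fubini_tonelli1//=; last 2 first.
- exact: measurableT_comp.
- by move=> t; rewrite lee_fin prodr_ge0.
have := IHn (fun k => h k.+1) (fun k => m k.+1) (distribution mu stail)
  (is_product_measure_tail muE) (fun k => mh k.+1) (fun k => h0 k.+1).
rewrite /fubini_F big_ord_recl => IH; rewrite -[X in (_ * X)%E]IH.
rewrite -ge0_integralZr//; first last.
- by apply: integral_ge0 => t _; rewrite lee_fin prodr_ge0.
- by move=> x _; rewrite lee_fin.
- exact/measurable_EFinP.
apply: eq_integral => x _; rewrite -ge0_integralZl//; first last.
- by rewrite lee_fin.
- by move=> t _; rewrite lee_fin prodr_ge0.
- apply/measurable_EFinP.
  by apply: (@measurable_prod_coord n (fun k => h k.+1)) => k; exact: mh.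
by apply: eq_integral => t _ /=; rewrite big_ord_recl EFinM.
Qed.

End sequences.

(** * Kakutani's dichotomy *)

Lemma measurable_sqrt (R : realType) : measurable_fun setT (@Num.sqrt R).
Proof. exact: continuous_measurable_fun (@sqrt_continuous R). Qed.

Section hellinger.
Context d (T : measurableType d) (R : realType).
Variables (mu : {measure set T -> \bar R}) (a b : T -> R) (r : R).
Hypotheses (ma : measurable_fun setT a) (mb : measurable_fun setT b).
Hypotheses (a0 : forall x, 0 <= a x) (b0 : forall x, 0 <= b x).
Hypothesis a1 : (\int[mu]_x (a x)%:E = 1)%E.
Hypothesis b1 : (\int[mu]_x (b x)%:E = 1)%E.
Hypothesis ab : (\int[mu]_x (Num.sqrt (a x * b x))%:E = r%:E)%E.

(* Linearized Cauchy-Schwarz: with s = sqrt a and t = sqrt b,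
   |s^2 - t^2| <= (s - t)^2 / (2 e) + e (s^2 + t^2). *)
Lemma integral_le_hellinger (e : R) A : 0 < e -> measurable A ->
  (\int[mu]_(x in A) (a x)%:E <=
   \int[mu]_(x in A) (b x)%:E + ((1 - r) / e + 2 * e)%:E)%E.
Proof.
move=> e0 mA.
have mab : measurable_fun setT (fun x => Num.sqrt (a x * b x)).
  apply: (@measurableT_comp _ _ _ _ _ _ (@Num.sqrt R)) => //.
    exact: measurable_sqrt.
  exact: measurable_funM.
(* Expanded form of the bound, whose terms have known integrals; [GE] gives the form that shows its
   sign. *)
pose G x := ((e * 2)^-1 + e) * (a x + b x) - e^-1 * Num.sqrt (a x * b x).
have GE x : G x = (Num.sqrt (a x) - Num.sqrt (b x)) ^+ 2 / (e * 2) +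
    e * (a x + b x).
  rewrite /G sqrrB !sqr_sqrtr// sqrtrM// -mulr_natr.
  by field; rewrite gt_eqF.
have G0 x : 0 <= G x.
  rewrite GE addr_ge0//; last by rewrite mulr_ge0 ?addr_ge0// ltW.
  by rewrite divr_ge0 ?sqr_ge0// mulr_ge0// ltW.
have aG x : a x <= b x + G x.
  rewrite GE; move: (sqr_sqrtr (a0 x)) (sqr_sqrtr (b0 x)).
  set s := Num.sqrt (a x); set t := Num.sqrt (b x) => <- <-.
  rewrite -subr_ge0.
  (* Completing the square exhibits the difference as a sum of nonnegative terms. *)
  have -> : t ^+ 2 + ((s - t) ^+ 2 / (e * 2) + e * (s ^+ 2 + t ^+ 2)) - s ^+ 2 =
     ((s - t) - e * (s + t)) ^+ 2 / (e * 2) + e * (s - t) ^+ 2 / 2.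
    by field; rewrite gt_eqF.
  rewrite addr_ge0// divr_ge0 ?sqr_ge0//; first by rewrite mulr_ge0// ltW.
  by rewrite mulr_ge0 ?sqr_ge0// ltW.
have mG : measurable_fun setT G.
  apply: measurable_funB; apply: measurable_funM => //.
  exact: measurable_funD.
have intG : (\int[mu]_x (G x)%:E = ((1 - r) / e + 2 * e)%:E)%E.
  (* The subtracted term is moved to the left, so that only nonnegative functions are integrated. *)
  have : (\int[mu]_x (G x)%:E + (e^-1 * r)%:E =
      ((e * 2)^-1 + e)%:E * (1 + 1))%E.
    rewrite EFinM -ab -{1}a1 -b1 -ge0_integralZl//; last 2 first.
    - exact/measurable_EFinP.
    - by rewrite lee_fin invr_ge0 ltW.
    rewrite -ge0_integralD//; last 4 first.
    - by move=> x _; rewrite lee_fin.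
    - exact/measurable_EFinP.
    - by move=> x _; rewrite lee_fin mulr_ge0 ?invr_ge0// ltW.
    - by apply/measurable_EFinP; exact: measurable_funM.
    rewrite -ge0_integralD//; last 4 first.
    - by move=> x _; rewrite lee_fin.
    - exact/measurable_EFinP.
    - by move=> x _; rewrite lee_fin.
    - exact/measurable_EFinP.
    rewrite -ge0_integralZl//; first last.
    - by rewrite lee_fin addr_ge0 ?invr_ge0 ?mulr_ge0// ltW.
    - by move=> x _; rewrite lee_fin addr_ge0.
    - by apply/measurable_EFinP; exact: measurable_funD.
    by apply: eq_integral => x _; rewrite -!EFinD -EFinM subrK.
  case: (\int[mu]_x (G x)%:E)%E => [s| |] //=.
  move=> /eqP; rewrite -!EFinD -EFinM eqe => /eqP sE; congr EFin.
  apply: (addIr (e^-1 * r)); rewrite sE.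
  by field; rewrite gt_eqF.
apply: (@le_trans _ _ (\int[mu]_(x in A) ((b x)%:E + (G x)%:E))%E).
  apply: ge0_le_integral => //.
  - by move=> x _; rewrite lee_fin.
  - by apply: measurable_funTS; exact/measurable_EFinP.
  - by apply: measurable_funTS; apply/measurable_EFinP; exact: measurable_funD.
  - by move=> x _; rewrite -EFinD lee_fin.
rewrite ge0_integralD//; first last.
- by apply: measurable_funTS; exact/measurable_EFinP.
- by move=> x _; rewrite lee_fin.
- by apply: measurable_funTS; exact/measurable_EFinP.
- by move=> x _; rewrite lee_fin.
rewrite leeD2l// -intG; apply: ge0_subset_integral => //.
  exact/measurable_EFinP.
by move=> x _; rewrite lee_fin.
Qed.

End hellinger.

Section kakutani.
Context d (K : measurableType d) (R : realType).
Local Notation S := (seqspace K).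
Variables (p q : nat -> probability K R) (f : nat -> K -> R) (rho : nat -> R).
Hypothesis mf : forall k, measurable_fun setT (f k).
Hypothesis f_gt0 : forall k x, 0 < f k x.
Hypothesis qE : forall k (h : K -> R), measurable_fun setT h ->
  (forall x, 0 <= h x) ->
  (\int[q k]_x (h x)%:E = \int[p k]_x (h x * f k x)%:E)%E.
Hypothesis rhoE :
  forall k, (\int[p k]_x (Num.sqrt (f k x))%:E = (rho k)%:E)%E.
Variables mu nu : probability S R.
Hypotheses (muE : is_product_measure p mu) (nuE : is_product_measure q nu).

Let F n (t : S) : R := \prod_(k < n) f k (t k).

Let mF n : measurable_fun setT (F n).
Proof. exact: measurable_prod_coord. Qed.

Let F_gt0 n t : 0 < F n t.
Proof. by apply: prodr_gt0 => k _. Qed.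

Let F_ge0 n t : 0 <= F n t. Proof. exact/ltW. Qed.

Let msqrtf k : measurable_fun setT (fun x => Num.sqrt (f k x)).
Proof. by apply: measurableT_comp => //; exact: measurable_sqrt. Qed.

Let int_f k : (\int[p k]_x (f k x)%:E = 1)%E.
Proof.
transitivity (\int[q k]_x 1%:E)%E.
  rewrite (qE k (h := cst 1))//.
  by apply: eq_integral => x _; rewrite mul1r.
by rewrite integral_cst// mul1e; exact: probability_setT.
Qed.

Let int_F n : (\int[mu]_t (F n t)%:E = 1)%E.
Proof.
rewrite (integral_prod_coord n muE)//; last by move=> k x; exact/ltW.
by rewrite big1// => k _; exact: int_f.
Qed.

(** The product measure with factors [q k] for [k < n] and [p k] afterwards. *)
Let V n := density_prob (mF n) (F_ge0 n) (int_F n).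

Let sqrtF n t : Num.sqrt (F n t) = \prod_(k < n) Num.sqrt (f k (t k)).
Proof.
rewrite -[LHS]/(Num.sqrt (\prod_(k < n) f k (t k))).
elim: n => [|n IHn]; first by rewrite !big_ord0 sqrtr1.
by rewrite !big_ord_recr/= sqrtrM ?IHn// prodr_ge0// => k _; exact/ltW.
Qed.

Let int_sqrtF n :
  (\int[mu]_t (Num.sqrt (F n t))%:E = (\prod_(k < n) rho k)%:E)%E.
Proof.
under eq_integral do rewrite sqrtF.
rewrite (integral_prod_coord (h := fun k x => Num.sqrt (f k x)) n muE)//.
by rewrite -prodEFin; apply: eq_bigr => k _; exact: rhoE.
Qed.

(** For [k < m] the factor [f k] occurs twice, its root is [f k] itself and integrates to 1; from
    [m] on, the root of a single [f k] integrates to [rho k]. *)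
Let int_sqrtFF m n : (m <= n)%N ->
  (\int[mu]_t (Num.sqrt (F m t * F n t))%:E =
   (\prod_(m <= k < n) rho k)%:E)%E.
Proof.
move=> mn; pose w k x := if (k < m)%N then f k x else Num.sqrt (f k x).
have w0 k x : 0 <= w k x by rewrite /w; case: ifP => // _; exact/ltW.
have sqrtE t : Num.sqrt (F m t * F n t) = \prod_(k < n) w k (t k).
  have -> : F m t * F n t = (\prod_(k < n) w k (t k)) ^+ 2.
    rewrite /F -(big_mkord predT (fun k => f k (t k))).
    rewrite (big_nat_widen _ _ _ _ _ mn) big_mkord big_mkcond/= -prodrXl.
    rewrite -big_split/=; apply: eq_bigr => k _; rewrite /w.
    by case: ifP => _; rewrite ?mul1r ?expr2// -expr2 sqr_sqrtr// ltW.
  by rewrite sqrtr_sqr ger0_norm// prodr_ge0.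
under eq_integral do rewrite sqrtE.
rewrite (integral_prod_coord n muE)//; last first.
  by move=> k; rewrite /w; case: (k < m)%N.
rewrite -(big_mkord predT (fun k => \int[p k]_x (w k x)%:E)%E).
rewrite (big_cat_nat _ mn)//= -prodEFin big_nat big1 ?mul1e.
  rewrite [LHS]big_nat [RHS]big_nat; apply: eq_bigr => k /andP[mk kn].
  by rewrite -rhoE; apply: eq_integral => x _; rewrite /w ltnNge mk.
move=> k /andP[_ km]; rewrite -[RHS](int_f k).
by apply: eq_integral => x _; rewrite /w km.
Qed.

(** Padded to length [n], the cylinder has an indicator that is a product over coordinates; so is
    its product with [F n], and [qE] converts each factor. *)
Let nu_cylinder N A n : (forall k, measurable (A k)) -> (N <= n)%N ->
  nu (cylinder N A) = V n (cylinder N A).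
Proof.
move=> mA Nn; pose B k := if (k < N)%N then A k else setT.
have mB k : measurable (B k) by rewrite /B; case: ifP.
have cylE : cylinder N A = cylinder n B.
  apply/seteqP; split => t /= h k kn.
    by rewrite /B; case: ifP => // kN; exact: h.
  by have := h k (leq_trans kn Nn); rewrite /B kn.
rewrite cylE nuE// /V /density_prob integral_mkcond.
transitivity (\int[mu]_t (\prod_(k < n) (\1_(B k) (t k) * f k (t k)))%:E)%E.
  rewrite (integral_prod_coord (h := fun k x => \1_(B k) x * f k x) n muE)//.
  - apply: eq_bigr => k _; rewrite -(qE k (h := \1_(B k)))//.
    by rewrite integral_indic// setIT.
  - by move=> k; apply: measurable_funM => //; exact: measurable_indic.
  - by move=> k x; rewrite mulr_ge0// ltW.
apply: eq_integral => t _; rewrite big_split/= patchE.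
case: ifPn => [|/negP] tB.
  rewrite big1 ?mul1r// => k _; rewrite indicE mem_set//.
  by move: tB; rewrite inE; apply.
have [k kB] : exists k : 'I_n, ~ B k (t k).
  apply: contra_notP tB => /forallNP h; rewrite inE => k kn.
  exact: (contrapT (h (Ordinal kn))).
by rewrite (bigD1 k)//= indicE memNset// !mul0r.
Qed.

Let V_cauchy (e : R) : (forall e, 0 < e -> exists m, forall n, (m <= n)%N ->
    1 - e <= \prod_(m <= k < n) rho k) -> 0 < e ->
  exists m, forall n A, (m <= n)%N -> measurable A ->
    `|fine (V n A) - fine (V m A)| <= e.
Proof.
move=> rho1 e0; have e4 : 0 < e / 4 by rewrite divr_gt0.
(* With parameter [e / 4] in [integral_le_hellinger], this makes the two error terms at most [e / 2]
   each, uniformly in [A]. *)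
have [|m mP] := rho1 (e / 4 * (e / 2)); first by rewrite mulr_gt0// divr_gt0.
exists m => n A mn mA; have := mP n mn; set r := \prod_(_ <= _ < _) _ => rP.
have re : (1 - r) / (e / 4) + 2 * (e / 4) <= e.
  have : (1 - r) / (e / 4) <= e / 2 by rewrite ler_pdivrMr//; lra.
  lra.
have Vfin k : V k A \is a fin_num by exact: fin_num_measure.
have int_sqrtFF' :
    (\int[mu]_t (Num.sqrt (F n t * F m t))%:E = r%:E)%E.
  by rewrite -int_sqrtFF//; apply: eq_integral => t _; rewrite mulrC.
have : (V m A <= V n A + ((1 - r) / (e / 4) + 2 * (e / 4))%:E)%E.
  exact: (integral_le_hellinger _ _ _ _ _ _ (int_sqrtFF mn)).
have : (V n A <= V m A + ((1 - r) / (e / 4) + 2 * (e / 4))%:E)%E.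
  exact: (integral_le_hellinger _ _ _ _ _ _ int_sqrtFF').
rewrite -(fineK (Vfin m)) -(fineK (Vfin n)) -!EFinD !lee_fin /= => le1 le2.
rewrite ler_norml; apply/andP; split; lra.
Qed.

(** Every [V n] has a density with respect to [mu], so it vanishes on [mu]-null sets, and so does
    the setwise limit [nu]. *)
Lemma kakutani_dominates : (forall e, 0 < e -> exists m, forall n, (m <= n)%N ->
    1 - e <= \prod_(m <= k < n) rho k) -> nu `<< mu.
Proof.
move=> /V_cauchy cauchy.
pose H := [set A : set S | measurable A /\
  fine (V n A) @[n --> \oo] --> fine (nu A)].
have lamH : lambda_system setT H.
  split => //.
  - split => //; apply: cvg_near_cst; apply: nearW => n.
    by congr fine; rewrite [RHS](@probability_setT _ _ _ nu); exact: int_F.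
  - move=> A B BA [mA hA] [mB hB]; split; first exact: measurableD.
    have E (P : probability S R) : fine (P (A `\` B)) = fine (P A) - fine (P B).
      rewrite measureD//; last by rewrite ltey_eq fin_num_measure.
      by rewrite (setIidr BA) fineB// fin_num_measure.
    by rewrite E; under eq_fun do rewrite (E (V _)); exact: cvgB.
  - move=> A ndA hA; have mA i : measurable (A i) by have [] := hA i.
    have mUA : measurable (\bigcup_i A i) by exact: bigcup_measurable.
    split => //; apply/cvgrPdist_le => /= e e0.
    (* Five errors link [nu] to [V n] on the union: from the union to [A i] under [nu], from [nu] to
       [V (maxn m n0)] and to [V m] on [A i], back to the union under [V m], and from [V m] to
       [V n]. The uniformity in [cauchy] makes [m] independent of [i]. *)
    have e5 : 0 < e / 5 by rewrite divr_gt0.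
    have [m mP] := cauchy _ e5.
    have cvgA (P : probability S R) :
        fine (P (A i)) @[i --> \oo] --> fine (P (\bigcup_i A i)).
      apply: fine_cvg; rewrite fineK ?fin_num_measure//.
      exact: nondecreasing_cvg_mu.
    have [i [nuA VA]] : exists i,
        `|fine (nu (\bigcup_i A i)) - fine (nu (A i))| <= e / 5 /\
        `|fine (V m (\bigcup_i A i)) - fine (V m (A i))| <= e / 5.
      have /cvgrPdist_le/(_ _ e5) h1 := cvgA nu.
      have /cvgrPdist_le/(_ _ e5) h2 := cvgA (V m).
      by have [i _ hi] := filterI h1 h2; exists i; exact: hi (leqnn i).
    have [_ /cvgrPdist_le/(_ _ e5)[n0 _ hn0]] := hA i.
    have := hn0 (maxn m n0) (leq_maxr _ _) => /= nuV.
    have := mP (maxn m n0) (A i) (leq_maxl _ _) (mA i) => VV.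
    exists m => // n /= mn; have := mP n _ mn mUA.
    move: nuA VA nuV VV; rewrite !ler_norml.
    move=> /andP[? ?] /andP[? ?] /andP[? ?] /andP[? ?] /andP[? ?].
    apply/andP; split; lra.
have measH : @measurable _ S `<=` H.
  rewrite sigma_algebra_cylinders; apply: lambda_system_subset => //.
    exact: setI_closed_cylinders.
  move=> _ [N [A [mA ->]]]; split; first exact: measurable_cylinder.
  apply: cvg_near_cst; exists N => // n /= Nn.
  by rewrite -(nu_cylinder mA Nn).
apply/null_content_dominatesP => A mA muA0; have [_ nuA] := measH _ mA.
have V0 n : V n A = 0%E.
  apply: null_set_integral => //; apply: measurable_funTS.
  exact/measurable_EFinP.
have : fine (nu A) = 0.
  apply: (cvg_unique _ nuA) => //; apply: cvg_near_cst; apply: nearW => n.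
  by rewrite V0.
by move=> h; rewrite -(fineK (fin_num_measure nu _ mA)) h.
Qed.

Let measurable_F_ge1 n : measurable [set t | 1 <= F n t].
Proof.
rewrite (_ : [set t | _] = F n @^-1` `[1, +oo[).
  by rewrite -[X in measurable X]setTI; exact: mF.
by apply/seteqP; split => t /=; rewrite in_itv/= andbT.
Qed.

Let mu_ge1 n : (mu [set t | 1 <= F n t]%R <= (\prod_(k < n) rho k)%:E)%E.
Proof.
rewrite -int_sqrtF.
have mB := measurable_F_ge1 n.
rewrite -(setIT [set t | _]) -integral_indic//; apply: ge0_le_integral => //.
- exact/measurable_EFinP/measurable_indic.
- apply/measurable_EFinP; apply: measurableT_comp (mF n).
  exact: measurable_sqrt.
- move=> t _; rewrite lee_fin indicE.
  case: (boolP (_ \in _)) => [|_]; last exact: sqrtr_ge0.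
  by rewrite inE/= => F1; rewrite -[leLHS]sqrtr1 ler_sqrt.
Qed.

(** Where [F n < 1] the inverse root of [F n] is at least 1, and its [nu]-integral is the same
    product of affinities because [f / sqrt f = sqrt f]. *)
Let nu_lt1 n : (nu (~` [set t | 1 <= F n t]%R) <= (\prod_(k < n) rho k)%:E)%E.
Proof.
have mB := measurable_F_ge1 n.
have msqrtfV k : measurable_fun setT (fun x => (Num.sqrt (f k x))^-1).
  (* Measurability of the inverse is obtained from that of the real power with exponent -1. *)
  have -> : (fun x => (Num.sqrt (f k x))^-1) =
      (fun x => Num.sqrt (f k x) `^ (-1)).
    by apply/funext => x; rewrite powR_inv1.
  exact: (measurableT_comp (measurable_powR _) (msqrtf k)).
have -> : ((\prod_(k < n) rho k)%:E =
    \int[nu]_t (\prod_(k < n) (Num.sqrt (f k (t k)))^-1)%:E)%E.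
  rewrite (integral_prod_coord (h := fun k x => (Num.sqrt (f k x))^-1) n nuE)//.
  - rewrite -prodEFin; apply: eq_bigr => k _; rewrite qE//.
    rewrite -rhoE; apply: eq_integral => x _.
    have : Num.sqrt (f k x) != 0 by rewrite gt_eqF ?sqrtr_gt0.
    have := sqr_sqrtr (ltW (f_gt0 k x)).
    by set y := Num.sqrt _ => <- y0; rewrite expr2 mulKf.
rewrite -(setIT (~` _)) -integral_indic//; last exact: measurableC.
apply: ge0_le_integral => //.
- by apply/measurable_EFinP/measurable_indic; exact: measurableC.
- apply/measurable_EFinP.
  exact: (measurable_prod_coord n msqrtfV).
- move=> t _; rewrite lee_fin prodfV -sqrtF indicE.
  case: (boolP (_ \in _)) => //=; last by rewrite invr_ge0.
  rewrite inE/= => /negP; rewrite -ltNge => F1.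
  rewrite invr_ge1 ?unitfE ?gt_eqF ?sqrtr_gt0//.
  by rewrite -[leRHS]sqrtr1 ler_sqrt// ltW.
Qed.

Lemma kakutani_singular : (forall e, 0 < e -> exists n,
    \prod_(k < n) rho k <= e) -> mutually_singular mu nu.
Proof.
move=> rho0.
(* A subsequence along which the bounds are summable, as Borel-Cantelli requires. *)
have /choice[N NP] j : exists n, \prod_(k < n) rho k <= 1 / (2 ^ j.+1)%:R.
  by apply: rho0; rewrite divr_gt0// ltr0n expn_gt0.
pose B j := [set t | 1 <= F (N j) t].
have mB j : measurable (B j) by exact: measurable_F_ge1.
have summable (u : nat -> \bar R) : (forall j, 0 <= u j)%E ->
    (forall j, u j <= (1 / (2 ^ j.+1)%:R)%:E)%E -> (\sum_(j <oo) u j < +oo)%E.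
  move=> u0 u2.
  apply: (@le_lt_trans _ _ (\sum_(j <oo) (1 / (2 ^ j.+1)%:R)%:E)%E).
    by apply: lee_nneseries.
  by apply: le_lt_trans (epsilon_trick0 xpredT ler01) _; rewrite ltry.
exists (lim_sup_set B); split.
  apply: bigcap_measurableType => // k _.
  by apply: bigcup_measurable.
split.
  apply: lim_sup_set_cvg0 => //; apply: summable => // j.
  by apply: le_trans (mu_ge1 _) _; rewrite lee_fin.
have mBC j : measurable (~` B j) by exact: measurableC.
apply/eqP; rewrite eq_le measure_ge0 andbT.
have <- : nu (lim_sup_set (fun j => ~` B j)) = 0%E.
  apply: lim_sup_set_cvg0 => //; apply: summable => // j.
  by apply: le_trans (nu_lt1 _) _; rewrite lee_fin.
apply: le_measure; rewrite ?inE.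
- apply: measurableC; apply: bigcap_measurableType => // k _.
  by apply: bigcup_measurable.
- apply: bigcap_measurableType => // k _.
  by apply: bigcup_measurable.
(* A point outside the upper limit of [B] is eventually outside every [B j], hence infinitely often
   in the complements. *)
rewrite /lim_sup_set setC_bigcap => t [n _]; rewrite setC_bigcup => tB.
move=> k _; exists (maxn n k); first exact: leq_maxr.
by apply: tB; exact: leq_maxl.
Qed.

End kakutani.

(** * Gaussian families *)

Lemma eq_sqr (R : realDomainType) (x y : R) :
  0 <= x -> 0 <= y -> x ^+ 2 = y ^+ 2 -> x = y.
Proof. by move=> x0 y0 /eqP; rewrite eqrXn2// => /eqP. Qed.

Section gaussian_family.
Context d (K : measurableType d) (R : realType).

(** Density of the centered Gaussian of deviation [t] relative to that of deviation [s], where [q]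
    is the squared norm in dimension [D]. Keeping [q] and [D] abstract treats both scalar fields at
    once. *)
Definition gauss_ratio (q : K -> R) (D : nat) (s t : R) (x : K) : R :=
  (s / t) ^+ D * expR (- ((t ^- 2 - s ^- 2) / 2 * q x)).

Lemma gauss_ratio_gt0 q D s t x : 0 < s -> 0 < t -> 0 < gauss_ratio q D s t x.
Proof. by move=> s0 t0; rewrite mulr_gt0 ?expR_gt0// exprn_gt0// divr_gt0. Qed.

(* [gauss s] has density proportional to [expR (- q / (2 s ^+ 2))] in
   dimension [D], up to a common reference measure. *)
Definition gaussian_family (q : K -> R) (D : nat)
    (gauss : R -> probability K R) :=
  forall s t, 0 < s -> 0 < t -> forall h : K -> \bar R,
    measurable_fun setT h -> (forall x, 0 <= h x)%E ->
    (\int[gauss t]_x h x =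
     \int[gauss s]_x (h x * (gauss_ratio q D s t x)%:E))%E.

Variables (q : K -> R) (D : nat) (gauss : R -> probability K R).
Hypothesis mq : measurable_fun setT q.
Hypothesis gaussE : gaussian_family q D gauss.

Lemma measurable_gauss_ratio s t : measurable_fun setT (gauss_ratio q D s t).
Proof.
apply: measurable_funM => //; apply: measurableT_comp => //.
by apply: measurable_funN => //; exact: measurable_funM.
Qed.

Lemma integral_gauss_ratio s t : 0 < s -> 0 < t ->
  (\int[gauss s]_x (gauss_ratio q D s t x)%:E = 1)%E.
Proof.
move=> s0 t0; transitivity (\int[gauss t]_x 1%:E)%E.
  rewrite (gaussE s0 t0 (h := cst 1%E))//.
  by apply: eq_integral => x _; rewrite mul1e.
by rewrite integral_cst// mul1e; exact: probability_setT.
Qed.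

Lemma integral_cst_gauss_ratio c s t : 0 < s -> 0 < t -> 0 <= c ->
  (\int[gauss s]_x (c * gauss_ratio q D s t x)%:E = c%:E)%E.
Proof.
move=> s0 t0 c0; under eq_integral do rewrite EFinM.
rewrite ge0_integralZl_EFin//.
- by rewrite integral_gauss_ratio// mule1.
- by move=> x _; rewrite lee_fin ltW// gauss_ratio_gt0.
- exact/measurable_EFinP/measurable_gauss_ratio.
Qed.

(** The Hellinger affinity in dimension one; dimension [D] gives its [D]-th power. *)
Definition gauss_affinity (s t : R) : R :=
  Num.sqrt (2 * s * t / (s ^+ 2 + t ^+ 2)).

(* The square root of the density ratio from [s] to [t] is a multiple of the
   one from [s] to [w], where [w ^- 2] is the mean of [s ^- 2] and [t ^- 2]. *)
Lemma integral_sqrt_gauss_ratio s t : 0 < s -> 0 < t ->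
  (\int[gauss s]_x (Num.sqrt (gauss_ratio q D s t x))%:E =
   (gauss_affinity s t ^+ D)%:E)%E.
Proof.
move=> s0 t0; have sn0 : s != 0 by rewrite gt_eqF.
have tn0 : t != 0 by rewrite gt_eqF.
have st0 : 0 < s ^+ 2 + t ^+ 2 by rewrite addr_gt0 ?exprn_gt0.
have w0 : 0 < Num.sqrt (2 / (s ^- 2 + t ^- 2)).
  by rewrite sqrtr_gt0 divr_gt0// addr_gt0// invr_gt0 exprn_gt0.
rewrite -(integral_cst_gauss_ratio s0 w0); last exact/exprn_ge0/sqrtr_ge0.
apply: eq_integral => x _; congr EFin.
set w := Num.sqrt (2 / _) in w0 *.
have w2 : w ^+ 2 = 2 / (s ^- 2 + t ^- 2).
  by rewrite sqr_sqrtr// ltW// -sqrtr_gt0.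
apply: eq_sqr; first exact: sqrtr_ge0.
  by rewrite mulr_ge0 ?exprn_ge0 ?sqrtr_ge0// ltW// gauss_ratio_gt0.
rewrite sqr_sqrtr; last by rewrite ltW// gauss_ratio_gt0.
have cE : (gauss_affinity s t * (s / w)) ^+ 2 = s / t.
  rewrite exprMn sqr_sqrtr; last by rewrite divr_ge0 ?mulr_ge0// ltW.
  rewrite exprMn exprVn w2; field.
  by rewrite sn0 tn0 [t ^+ 2 + _]addrC gt_eqF.
have eE : expR (- ((w ^- 2 - s ^- 2) / 2 * q x)) ^+ 2 =
    expR (- ((t ^- 2 - s ^- 2) / 2 * q x)).
  rewrite expr2 -expRD w2; congr expR.
  by field; rewrite sn0 tn0 [t ^+ 2 + _]addrC gt_eqF.
by rewrite /gauss_ratio [in RHS]mulrA -exprMn [RHS]exprMn eE [in RHS]exprAC cE.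
Qed.

(** The integrand is a constant multiple of the density ratio from [s] to [s / k], since
    [(s / k) ^- 2 = s ^- 2 + c]. *)
Lemma integral_expR_gauss s c : 0 < s -> 0 <= c ->
  (\int[gauss s]_x (expR (- (c / 2 * q x)))%:E =
   ((Num.sqrt (1 + c * s ^+ 2))^-1 ^+ D)%:E)%E.
Proof.
move=> s0 c0; set k := Num.sqrt _.
have k1 : 0 < 1 + c * s ^+ 2 by rewrite ltr_wpDr// mulr_ge0// sqr_ge0.
have k0 : 0 < k by rewrite sqrtr_gt0.
have sk0 : 0 < s / k by rewrite divr_gt0.
rewrite -(integral_cst_gauss_ratio s0 sk0); last first.
  by rewrite exprn_ge0// invr_ge0 ltW.
have sn0 : s != 0 by rewrite gt_eqF.
have cE : (s / k) ^- 2 - s ^- 2 = c.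
  rewrite exprMn exprVn sqr_sqrtr; last exact: ltW.
  by field; rewrite sn0 gt_eqF.
apply: eq_integral => x _; rewrite /gauss_ratio cE mulrA -exprMn.
rewrite (_ : k^-1 * _ = 1); last by field; rewrite sn0 gt_eqF.
by rewrite expr1n mul1r.
Qed.

(** * Standard deviations of a shift-invariant product *)

Section invariance.
Variables (mulK : K -> K -> K) (normK : K -> R).
Hypothesis mmulK : forall w, measurable_fun setT (mulK w).
Hypothesis normK_ge0 : forall w, 0 <= normK w.
Hypothesis qM : forall w x, q (mulK w x) = normK w ^+ 2 * q x.
Hypothesis D_gt0 : (0 < D)%N.

(** The two integrals of [expR (- q / 2)] are the [D]-th powers of the inverse roots of [1 + s ^+ 2]
    and [1 + (normK w * t) ^+ 2]; as [D] is positive, the bases coincide. *)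
Lemma gauss_dilation s t w : 0 < s -> 0 < t ->
  (forall A, measurable A -> gauss t (mulK w @^-1` A) = gauss s A) ->
  s = normK w * t.
Proof.
move=> s0 t0 gaussA.
pose X : {mfun K >-> K} :=
  HB.pack (mulK w) (isMeasurableFun.Build _ _ _ _ _ (mmulK w)).
have mexp c : measurable_fun setT (fun x => expR (- (c / 2 * q x))).
  apply: measurableT_comp => //; apply: measurable_funN => //.
  exact: measurable_funM.
have : (\int[gauss s]_x (expR (- (1 / 2 * q x)))%:E =
       \int[distribution (gauss t) X]_x (expR (- (1 / 2 * q x)))%:E)%E.
  by apply: eq_measure_integral => A mA _; exact/esym/gaussA.
rewrite ge0_integral_distribution; [|exact/measurable_EFinP|]; last first.
  by move=> x; rewrite lee_fin expR_ge0.
rewrite [RHS](_ : _ =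
    \int[gauss t]_x (expR (- (normK w ^+ 2 / 2 * q x)))%:E)%E; last first.
  apply: eq_integral => x _ /=; rewrite qM; congr (expR (- _))%:E.
  by field.
rewrite !integral_expR_gauss ?sqr_ge0// => -[] /eqP.
rewrite eqrXn2 ?invr_ge0 ?sqrtr_ge0// => /eqP/invr_inj/eqP.
rewrite eqr_sqrt; last 2 first.
- by rewrite addr_ge0// mulr_ge0// sqr_ge0.
- by rewrite addr_ge0// mulr_ge0// sqr_ge0.
rewrite mul1r -exprMn => /eqP/addrI; apply: eq_sqr; first exact: ltW.
by rewrite mulr_ge0// ltW.
Qed.

Lemma shift_invariant_sd w (sig : nat -> R) (mu : probability (seqspace K) R) :
  (forall n, 0 < sig n) -> is_product_measure (fun n => gauss (sig n)) mu ->
  shift_invariant mulK w mu ->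
  forall n, sig n = normK (w n.+1) * sig n.+1.
Proof.
move=> sig0 muE inv n; apply: gauss_dilation => // A mA.
(* Bases that constrain coordinate [k] only: the shift pulls the condition at [n] back to one at
   [n.+1]. *)
pose at_ (k : nat) (B : set K) (j : nat) : set K := if j == k then B else setT.
have mat k B : measurable B -> forall j, measurable (at_ k B j).
  by move=> mB j; rewrite /at_; case: ifP.
have coordE k B : measurable B ->
    mu (cylinder k.+1 (at_ k B)) = gauss (sig k) B.
  move=> mB; rewrite muE; last exact: mat.
  rewrite big_ord_recr/= big1 ?mul1e ?/at_ ?eqxx// => i _.
  by rewrite ltn_eqF//; exact: probability_setT.
have mwA : measurable (mulK (w n.+1) @^-1` A).
  by rewrite -[X in measurable X]setTI; exact: mmulK.
rewrite -coordE// -coordE// -[RHS]inv; last first.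
  by apply: measurable_cylinder; exact: mat.
congr (mu _); apply/seteqP; split => t /= h k kn; rewrite /at_.
  by case: eqP => // ->; have := h n.+1 (ltnSn _); rewrite /at_ eqxx.
by case: eqP => // ->; have := h n (ltnSn _); rewrite /at_ eqxx.
Qed.

End invariance.
End gaussian_family.

(** Tonelli and the change of density in each variable; exponents and dimensions add up. This yields
    the complex Gaussians from the real ones. *)
Lemma gaussian_family_prod d (K : measurableType d) (R : realType)
    (q : K -> R) D (gauss : R -> probability K R) :
  measurable_fun setT q -> gaussian_family q D gauss ->
  gaussian_family (fun z : K * K => q z.1 + q z.2) (D + D)
    (fun s => (gauss s \x gauss s)%E : probability (K * K)%type R).
Proof.
move=> mq gaussE s t s0 t0 h mh h0.
have mratio := measurable_gauss_ratio D mq s t.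
have mEratio : measurable_fun setT (EFin \o gauss_ratio q D s t).
  exact/measurable_EFinP.
have ratio0 x : 0 <= gauss_ratio q D s t x by rewrite ltW// gauss_ratio_gt0.
have mq2 : measurable_fun setT (fun z : K * K => q z.1 + q z.2).
  apply: measurable_funD; first exact: (measurableT_comp mq measurable_fst).
  exact: (measurableT_comp mq measurable_snd).
rewrite fubini_tonelli1// (gaussE s t)//; first last.
- by move=> x; apply: integral_ge0 => y _; exact: h0.
- exact: measurable_fun_fubini_tonelli_F.
rewrite [RHS]fubini_tonelli1//; first last.
- by move=> z; rewrite mule_ge0// lee_fin ltW// gauss_ratio_gt0.
- apply: emeasurable_funM => //; apply/measurable_EFinP.
  exact: measurable_gauss_ratio.
apply: eq_integral => x _; rewrite /fubini_F.
have mhx : measurable_fun setT (fun y => h (x, y)).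
  exact: (measurableT_comp mh (measurable_pair1 x)).
rewrite (gaussE s t)// -ge0_integralZr//; first last.
- by rewrite lee_fin.
- by move=> y _; rewrite mule_ge0// lee_fin.
- exact: emeasurable_funM.
apply: eq_integral => y _; rewrite -muleA -EFinM; congr (_ * _%:E)%E.
rewrite /gauss_ratio mulrACA -expRD -exprD; congr (_ * expR _).
by ring.
Qed.

(** * Comparing products of affinities with the series *)

Section affinity_series.
Context (R : realType).

(** Weierstrass's product inequality, from [(1 - x) * (1 - y) >= 1 - x - y] for nonnegative [x] and
    [y]. *)
Lemma prod_ge_1subsum (I : Type) (s : seq I) (x rho : I -> R) :
  (forall i, 0 <= x i <= 1) -> (forall i, 1 - x i <= rho i) ->
  1 - \sum_(i <- s) x i <= \prod_(i <- s) rho i.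
Proof.
move=> x01 xrho; elim: s => [|i s IHs]; first by rewrite !big_nil subr0.
rewrite !big_cons; have /andP[xi0 xi1] := x01 i.
have S0 : 0 <= \sum_(j <- s) x j.
  by apply: sumr_ge0 => j _; case/andP: (x01 j).
have P0 : 0 <= \prod_(j <- s) rho j.
  apply: prodr_ge0 => j _; apply: le_trans (xrho j).
  by rewrite subr_ge0; case/andP: (x01 j).
apply: (@le_trans _ _ ((1 - x i) * \prod_(j <- s) rho j)).
  apply: (@le_trans _ _ ((1 - x i) * (1 - \sum_(j <- s) x j))); first by nra.
  by rewrite ler_wpM2l// subr_ge0.
by rewrite ler_wpM2r.
Qed.

Lemma prod_le_expR (I : Type) (s : seq I) (x rho : I -> R) :
  (forall i, 0 <= rho i <= 1 - x i) ->
  \prod_(i <- s) rho i <= expR (- \sum_(i <- s) x i).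
Proof.
move=> rhox; rewrite -sumrN expR_sum; apply: ler_prod => i _.
have /andP[rho0 rho1] := rhox i; rewrite rho0 (le_trans rho1)//.
exact: expR_ge1Dx.
Qed.

(** For positive [s] and [t], this is one minus the square of [gauss_affinity s t]. *)
Definition affinity_defect (s t : R) : R := (s - t) ^+ 2 / (s ^+ 2 + t ^+ 2).

Lemma affinity_defectC s t : affinity_defect s t = affinity_defect t s.
Proof. by rewrite /affinity_defect -(opprB t s) sqrrN [s ^+ 2 + _]addrC. Qed.

Lemma affinity_defect_itv s t : 0 < s -> 0 < t -> 0 <= affinity_defect s t <= 1.
Proof.
move=> s0 t0; have st0 : 0 < s ^+ 2 + t ^+ 2 by rewrite addr_gt0 ?exprn_gt0.
rewrite /affinity_defect divr_ge0 ?sqr_ge0 ?(ltW st0)//= ler_pdivrMr// mul1r.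
rewrite -subr_ge0 (_ : _ - _ = 2 * (s * t)); last by ring.
by rewrite !mulr_ge0// ltW.
Qed.

(** With [x] the defect, the middle term is the square root of [1 - x] for [D = 1] and [1 - x]
    itself for [D = 2]. *)
Lemma gauss_affinity_bounds s t D : 0 < s -> 0 < t -> (0 < D <= 2)%N ->
  1 - affinity_defect s t <= gauss_affinity s t ^+ D
    <= 1 - affinity_defect s t / 2.
Proof.
move=> s0 t0 D12; have /andP[x0 x1] := affinity_defect_itv s0 t0.
have st0 : 0 < s ^+ 2 + t ^+ 2 by rewrite addr_gt0 ?exprn_gt0.
have a2 : gauss_affinity s t ^+ 2 = 1 - affinity_defect s t.
  rewrite sqr_sqrtr; last by rewrite divr_ge0 ?mulr_ge0// ltW.
  by rewrite /affinity_defect; field; rewrite gt_eqF.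
have a0 : 0 <= gauss_affinity s t by exact: sqrtr_ge0.
move: D12 a2 a0 x0 x1.
set a := gauss_affinity _ _; set x := affinity_defect _ _.
move: D => [|[|[|]]]// _ a2 a0 x0 x1; rewrite ?expr1 ?a2.
  by apply/andP; split; nra.
by apply/andP; split; nra.
Qed.

Lemma sqr_1subdiv_ge_defect s t : 0 < s -> 0 < t ->
  affinity_defect s t <= (1 - t / s) ^+ 2.
Proof.
move=> s0 t0; have st0 : 0 < s ^+ 2 + t ^+ 2 by rewrite addr_gt0 ?exprn_gt0.
rewrite (_ : (1 - t / s) ^+ 2 = (s - t) ^+ 2 / s ^+ 2); last first.
  by field; rewrite gt_eqF.
rewrite ler_wpM2l ?sqr_ge0// lef_pV2 ?posrE ?exprn_gt0//.
by rewrite lerDl sqr_ge0.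
Qed.

Lemma sqr_1subdiv_le_defect s t : 0 < s -> 0 < t ->
  affinity_defect s t < 5^-1 -> (1 - t / s) ^+ 2 <= 5 * affinity_defect s t.
Proof.
move=> s0 t0; have st0 : 0 < s ^+ 2 + t ^+ 2 by rewrite addr_gt0 ?exprn_gt0.
rewrite /affinity_defect ltr_pdivrMr// => st.
(* The hypothesis reads [(2 * s - t) * (s - 2 * t) < 0], so [s ^+ 2 + t ^+ 2] is at most
   [5 * s ^+ 2]: hence the constant 5. *)
have t2s : t < 2 * s by nra.
rewrite (_ : (1 - t / s) ^+ 2 = (s - t) ^+ 2 / s ^+ 2); last first.
  by field; rewrite gt_eqF.
rewrite mulrCA ler_wpM2l ?sqr_ge0// ler_pdivlMr// mulrC.
rewrite ler_pdivrMr ?exprn_gt0//.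
by nra.
Qed.

Variables (s t : nat -> R).
Hypotheses (s0 : forall n, 0 < s n) (t0 : forall n, 0 < t n).
Let a n := (1 - t n / s n) ^+ 2.
Let x n := affinity_defect (s n) (t n).
Local Notation S := (\sum_(1 <= n <oo) (a n)%:E)%E.

Let a_ge0 n : 0 <= a n. Proof. exact: sqr_ge0. Qed.
Let x_ge0 n : 0 <= x n.
Proof. by case/andP: (affinity_defect_itv (s0 n) (t0 n)). Qed.

Lemma affinity_defect_tail : (S < +oo)%E -> forall e, 0 < e ->
  exists m, forall n, (m <= n)%N -> \sum_(m <= k < n) x k <= e.
Proof.
move=> Soo e e0.
have tail0 : (\sum_(m <= n <oo) (a n)%:E @[m --> \oo] --> 0)%E.
  apply: nneseries_tail_cvg; last by move=> k; rewrite lee_fin.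
  (* The tail criterion sums from 0 while [S] starts at 1; the finite zeroth term is split off. *)
  rewrite nneseries_recl//; first by rewrite lte_add_pinfty ?ltry.
  by move=> k; rewrite lee_fin.
have [finS /cvgr_lt/(_ e e0) ltS] := (fine_cvgP _ _).1 tail0.
have [m _ /(_ m (leqnn m)) [/= fSm Sm]] := filterI finS ltS.
exists m => n mn; rewrite -lee_fin.
have {}Sm : (\sum_(m <= n <oo) (a n)%:E < e%:E)%E.
  by rewrite -(fineK fSm) lte_fin.
rewrite (le_trans _ (ltW Sm))//.
apply: (@le_trans _ _ (\sum_(m <= k < n) (a k)%:E)%E).
  rewrite sumEFin lee_fin; apply: ler_sum => k _.
  exact: sqr_1subdiv_ge_defect.
by apply: nneseries_lim_ge => k _ _; rewrite lee_fin.
Qed.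

(** If the partial sums of [x] were bounded by [C], then [x n] would tend to 0, and [a n <= 5 * x n]
    from some rank on would bound [S]. *)
Lemma affinity_defect_unbounded : ~ (S < +oo)%E -> forall C, exists n,
  C <= \sum_(k < n) x k.
Proof.
move=> Soo C; apply: contrapT => /forallNP xC; apply: Soo.
have {}xC n : \sum_(0 <= k < n) x k <= C.
  by rewrite big_mkord; have /negP := xC n; rewrite -ltNge => /ltW.
have : x n @[n --> \oo] --> 0.
  apply: cvg_series_cvg_0; apply: nondecreasing_is_cvgn.
    apply/nondecreasing_seqP => n; rewrite /series/= big_nat_recr//=.
    by rewrite lerDl.
  by exists C => _ [n _ <-]; exact: xC.
move=> /cvgr_lt/(_ 5^-1)[|N _ xN]; first by rewrite invr_gt0.
suff SC : (S <= (\sum_(0 <= k < N) a k + 5 * C)%:E)%E.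
  exact: le_lt_trans SC (ltry _).
apply: lime_le; first by apply: is_cvg_nneseries => k _ _; rewrite lee_fin.
apply: nearW => n; rewrite sumEFin lee_fin.
(* Extending the range to [maxn n N] lets the sum be cut at [N] even when [n < N]; the added terms
   are nonnegative. *)
apply: (@le_trans _ _ (\sum_(0 <= k < maxn n N) a k)).
  case: n => [|n]; first by rewrite big_geq// sumr_ge0.
  rewrite [leRHS](big_cat_nat _ (leq_maxl n.+1 N))//= [X in X + _]big_ltn//.
  by rewrite -addrA addrCA lerDl addr_ge0// sumr_ge0.
rewrite (big_cat_nat _ (leq_maxr n N))//= lerD2l.
apply: (@le_trans _ _ (5 * \sum_(N <= k < maxn n N) x k)).
  rewrite mulr_sumr big_nat [leRHS]big_nat; apply: ler_sum => k /andP[Nk _].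
  by apply: sqr_1subdiv_le_defect => //; exact: xN.
rewrite ler_pM2l// (le_trans _ (xC (maxn n N)))//.
by rewrite [leRHS](big_cat_nat _ (leq_maxr n N))//= lerDr sumr_ge0.
Qed.

End affinity_series.

(** * The dichotomy for Gaussian families of dimension one or two *)

Section dichotomy.
Context d (K : measurableType d) (R : realType).
Variables (q : K -> R) (D : nat) (gauss : R -> probability K R).
Hypothesis mq : measurable_fun setT q.
Hypothesis gaussE : gaussian_family q D gauss.
Hypothesis D12 : (0 < D <= 2)%N.

Section two_products.
Variables (s t : nat -> R) (mu nu : probability (seqspace K) R).
Hypotheses (s0 : forall n, 0 < s n) (t0 : forall n, 0 < t n).
Hypothesis muE : is_product_measure (fun n => gauss (s n)) mu.
Hypothesis nuE : is_product_measure (fun n => gauss (t n)) nu.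

Lemma gauss_product_dominates :
  (forall e, 0 < e -> exists m, forall n, (m <= n)%N ->
     \sum_(m <= k < n) affinity_defect (s k) (t k) <= e) -> nu `<< mu.
Proof.
move=> small.
apply: (@kakutani_dominates _ _ _ _ _ (fun k => gauss_ratio q D (s k) (t k))
  (fun k => gauss_affinity (s k) (t k) ^+ D) _ _ _ _ _ _ muE nuE).
- by move=> k; exact: measurable_gauss_ratio.
- by move=> k x; exact: gauss_ratio_gt0.
- move=> k h mh h0; rewrite (gaussE (s0 k) (t0 k))//.
  exact/measurable_EFinP.
- by move=> k; exact: integral_sqrt_gauss_ratio.
move=> e /small[m mP]; exists m => n /mP me.
apply: (@le_trans _ _ (1 - \sum_(m <= k < n) affinity_defect (s k) (t k))).
  by rewrite lerB.
apply: prod_ge_1subsum => k; first exact: affinity_defect_itv.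
by have /andP[] := gauss_affinity_bounds (s0 k) (t0 k) D12.
Qed.

Lemma gauss_product_singular :
  (forall C, exists n, C <= \sum_(k < n) affinity_defect (s k) (t k)) ->
  mutually_singular mu nu.
Proof.
move=> large.
apply: (@kakutani_singular _ _ _ _ _ (fun k => gauss_ratio q D (s k) (t k))
  (fun k => gauss_affinity (s k) (t k) ^+ D) _ _ _ _ _ _ muE nuE).
- by move=> k; exact: measurable_gauss_ratio.
- by move=> k x; exact: gauss_ratio_gt0.
- move=> k h mh h0; rewrite (gaussE (s0 k) (t0 k))//.
  exact/measurable_EFinP.
- by move=> k; exact: integral_sqrt_gauss_ratio.
(* The product is at most [expR (- C / 2)] once the defects sum to at least [C]; this equals [e] for
   [C = - 2 * ln e]. *)
move=> e e0; have [n nC] := large (- 2 * ln e); exists n.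
apply: (@le_trans _ _
    (expR (- \sum_(k < n) (affinity_defect (s k) (t k) / 2)))).
  apply: prod_le_expR => k; rewrite exprn_ge0 ?sqrtr_ge0//=.
  by have /andP[] := gauss_affinity_bounds (s0 k) (t0 k) D12.
rewrite -[leRHS]lnK ?posrE// ler_expR -mulr_suml; lra.
Qed.

End two_products.

Variables (mulK : K -> K -> K) (normK : K -> R) (zeroK oneK : K).
Hypothesis mmulK : forall w, measurable_fun setT (mulK w).
Hypothesis normK_gt0 : forall w, w != zeroK -> 0 < normK w.
Hypothesis normK_ge0 : forall w, 0 <= normK w.
Hypothesis normKM : {morph normK : x y / mulK x y >-> x * y}.
Hypothesis normK1 : normK oneK = 1.
Hypothesis qM : forall w x, q (mulK w x) = normK w ^+ 2 * q x.

Lemma gaussian_dichotomy :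
  gaussian_dichotomy_statement zeroK oneK mulK normK
    (fun s => gauss s : set K -> \bar R).
Proof.
move=> u v su sv mu_u mu_v u0 v0 [su0 muE] [sv0 nuE] inv_u inv_v.
(* The cylinder of length 0 is the whole space and its measure is the empty product. *)
have setTE m (mu : {measure set (seqspace K) -> \bar R}) :
    is_product_measure m mu -> mu setT = 1%E.
  move=> /(_ 0%N (fun=> setT) (fun=> measurableT)); rewrite big_ord0 => <-.
  by congr (mu _); apply/seteqP; split.
pose mu : probability (seqspace K) R :=
  measure_probability (setTE (fun n => gauss (su n)) mu_u muE).
pose nu : probability (seqspace K) R :=
  measure_probability (setTE (fun n => gauss (sv n)) mu_v nuE).
have D0 : (0 < D)%N by case/andP: D12.
(* Iterating the relation between consecutive deviations expresses the norm of the weight product as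
   [sig 0 / sig n]. *)
have sdE w sig (mu' : probability (seqspace K) R) :
    (forall n, w n != zeroK) -> (forall n, 0 < sig n) ->
    is_product_measure (fun n => gauss (sig n)) mu' ->
    shift_invariant mulK w mu' ->
    forall n, sig 0%N = normK (\big[mulK/oneK]_(1 <= i < n.+1) w i) * sig n.
  move=> w0 sig0 mu'E inv n.
  rewrite (big_morph normK normKM normK1).
  elim: n => [|n IHn]; first by rewrite big_geq// mul1r.
  rewrite big_nat_recr//= IHn -mulrA.
  congr (_ * _).
  exact: (shift_invariant_sd mq gaussE mmulK normK_ge0 qM D0 sig0 mu'E inv).
have normP w n : (forall n, w n != zeroK) ->
    normK (\big[mulK/oneK]_(1 <= i < n.+1) w i) != 0.
  move=> w0; rewrite (big_morph normK normKM normK1) gt_eqF//.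
  by rewrite prodr_gt0// => i _; exact: normK_gt0.
set S := (\sum_(1 <= n <oo) _)%E.
have SE : S = (\sum_(1 <= n <oo) ((1 - sv n / su n) ^+ 2)%:E)%E.
  apply: eq_eseriesr => n _; congr ((1 - _) ^+ 2)%:E.
  rewrite (sdE u su mu u0 su0 muE inv_u n) (sdE v sv nu v0 sv0 nuE inv_v n).
  by field; rewrite !normP// gt_eqF.
(* Convergence gives equivalence, the defect being symmetric; divergence gives singularity. *)
have [Soo|Soo] := pselect (S < +oo)%E.
  have small := affinity_defect_tail su0 sv0.
  rewrite -SE in small.
  have equiv : measures_equivalent mu_u mu_v.
    split; last first.
      exact: (gauss_product_dominates (mu := mu) (nu := nu)
        su0 sv0 muE nuE (small Soo)).
    apply: (gauss_product_dominates (mu := nu) (nu := mu) sv0 su0 nuE muE).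
    move=> e /(small Soo)[m mP]; exists m => n /mP; congr (_ <= _).
    by apply: eq_bigr => k _; rewrite affinity_defectC.
  by split; [left|].
have sing : mutually_singular mu nu.
  apply: (gauss_product_singular (mu := mu) (nu := nu) su0 sv0 muE nuE).
  by apply: affinity_defect_unbounded => //; rewrite -SE.
split; first by right.
(* Singularity excludes equivalence: [A] and its complement would both be [nu]-null, against total
   mass 1. *)
split => // -[uv vu]; have [A [mA [muA nuA]]] := sing.
have mu_vA : mu_v A = 0%E by exact: ((null_content_dominatesP _ _).1 vu).
have := probability_setC nu mA; rewrite [LHS]nuA [nu A]mu_vA sube0 => /eqP.
by rewrite eq_sym onee_eq0.
Qed.

End dichotomy.

(** * Normal laws on the line *)

Section real_gaussian.
Context (R : realType).

Lemma normal_pdf_ratio (s t x : R) : 0 < s -> 0 < t ->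
  normal_pdf 0 t x =
  gauss_ratio (fun x : R => x ^+ 2) 1 s t x * normal_pdf 0 s x.
Proof.
move=> s0 t0; have sn0 : s != 0 by rewrite gt_eqF.
have tn0 : t != 0 by rewrite gt_eqF.
(* The dependence on [r] is isolated, so that the quotient of the peaks is [s / t]. *)
have peakE (r : R) : 0 < r -> normal_peak r = r^-1 * (Num.sqrt (pi *+ 2))^-1.
  move=> r0; rewrite /normal_peak -mulrnAr sqrtrM ?sqr_ge0// sqrtr_sqr.
  by rewrite gtr0_norm// invfM.
rewrite !normal_pdfE// !peakE// /gauss_ratio /normal_fun expr1 subr0.
rewrite [RHS]mulrACA -expRD; congr (_ * expR _).
  by field; rewrite sn0 tn0 gt_eqF// sqrtr_gt0 pmulrn_lgt0// pi_gt0.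
by field; rewrite sn0 tn0.
Qed.

Local Notation K := (measurableTypeR R).
Local Notation normal s := (normal_prob (0 : R) s).
Local Notation sq := (fun x : K => (x : R) ^+ 2).

Lemma measurable_sq : measurable_fun setT sq.
Proof. exact: (measurable_funX 2 (@measurable_id _ R setT)). Qed.

Lemma gaussian_family_normal :
  gaussian_family sq 1 (fun s => normal s : probability K R).
Proof.
move=> s t s0 t0 h mh h0.
have mratio : measurable_fun setT (gauss_ratio sq 1 s t).
  by apply: measurable_gauss_ratio; exact: measurable_sq.
have densE r (k : K -> \bar R) : measurable_fun setT k ->
    (forall x, 0 <= k x)%E -> (\int[normal r]_x k x =
      \int[lebesgue_measure]_x (k x * (normal_pdf 0 r x)%:E))%E.
  apply: ge0_integral_density => //; first exact: measurable_normal_pdf.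
  exact: normal_pdf_ge0.
have mhr : measurable_fun setT
    (fun x => h x * (gauss_ratio sq 1 s t x)%:E)%E.
  by apply: emeasurable_funM => //; exact/measurable_EFinP.
have hr0 x : (0 <= h x * (gauss_ratio sq 1 s t x)%:E)%E.
  by rewrite mule_ge0// lee_fin ltW// gauss_ratio_gt0.
rewrite (densE t h mh h0) (densE s _ mhr hr0).
apply: eq_integral => x _; rewrite -muleA -EFinM.
by rewrite (normal_pdf_ratio x s0 t0).
Qed.

End real_gaussian.

(* Theorem 5.7, for K = R (first conjunct) and K = C ~ R^2 (second conjunct). *)
Theorem theorem5p7 (R : realType) :
  @gaussian_dichotomy_statement _ R R 0 1 (fun x y => x * y) (fun x => `|x|)
     (@rgauss R) /\
  @gaussian_dichotomy_statement _ (R * R)%type R (0, 0) cone cmul cnorm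
     (@cgauss R).
Proof.
(* R and measurableTypeR R carry different displays but convertible
   sigma-algebras. *)
split.
  suff : @gaussian_dichotomy_statement _ (measurableTypeR R) R (0 : R) (1 : R)
      (fun x y : R => x * y) (fun x : R => `|x|) (@rgauss R) by [].
  apply: (gaussian_dichotomy (@measurable_sq R)
    (@gaussian_family_normal R)) => //.
  - move=> w; suff : measurable_fun setT (fun x : R => w * x) by [].
    exact: measurable_funM.
  - by move=> w; rewrite normr_gt0.
  - exact: normrM.
  - exact: normr1.
  - by move=> w x; rewrite exprMn real_normK// num_real.
suff : @gaussian_dichotomy_statement _
    (measurableTypeR R * measurableTypeR R)%type R
    (0 : R, 0 : R) (@cone R) (@cmul R) (@cnorm R) (@cgauss R) by [].
have sq_ge0 (z : R * R) : 0 <= z.1 ^+ 2 + z.2 ^+ 2 by rewrite addr_ge0 ?sqr_ge0.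
have measurable_sqnorm : measurable_fun setT
    (fun z : measurableTypeR R * measurableTypeR R =>
       (z.1 : R) ^+ 2 + (z.2 : R) ^+ 2).
  apply: measurable_funD.
    exact: (measurableT_comp (@measurable_sq R) measurable_fst).
  exact: (measurableT_comp (@measurable_sq R) measurable_snd).
(* Two independent real coordinates form a family of dimension [1 + 1], within the bound on [D]. *)
apply: (gaussian_dichotomy measurable_sqnorm
  (gaussian_family_prod (@measurable_sq R) (@gaussian_family_normal R))) => //.
- move=> w; apply/measurable_fun_pairP; split.
    apply: (@measurable_funB _ (R * R)%type R setT
      (fun z => w.1 * z.1) (fun z => w.2 * z.2)).
    - by apply: measurable_funM => //; exact: measurable_fst.
    - by apply: measurable_funM => //; exact: measurable_snd.
  apply: (@measurable_funD _ (R * R)%type R setT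
    (fun z => w.1 * z.2) (fun z => w.2 * z.1)).
  - by apply: measurable_funM => //; exact: measurable_snd.
  - by apply: measurable_funM => //; exact: measurable_fst.
- move=> w w0; rewrite sqrtr_gt0 lt0r sq_ge0 andbT.
  apply: contra w0; rewrite paddr_eq0 ?sqr_ge0// !sqrf_eq0.
  by case: w => a b /= /andP[/eqP-> /eqP->].
- by move=> w; exact: sqrtr_ge0.
(* The two-squares identity makes the modulus multiplicative. *)
- by move=> z w; rewrite /cnorm -sqrtrM//=; congr Num.sqrt; ring.
- by rewrite /cnorm /cone/= expr1n expr0n addr0 sqrtr1.
- by move=> w x; rewrite sqr_sqrtr//=; ring.
Qed.
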